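(* Let $n\ge 3$ be odd and let $q\in\Bbbk$ be a primitive $n$-th root of unity. Fix a $u_q(\mathfrak{sl}_2)$-module algebra structure on $A=\Bbbk[u]/(u^n-1)$ of the form $$K\cdot u=q^2u,\qquad F\cdot u=\gamma 1,\qquad E\cdot u=\delta u^2,$$ with $\gamma,\delta\in\Bbbk$ and $\gamma\delta=-q$. If the action of $u_q(\mathfrak{sl}_2)$ on $A$ extends to an action of $D(u_q(\mathfrak{sl}_2))$ so that $A$ is a $D(u_q(\mathfrak{sl}_2))$-module algebra, then the action is specified by one of the following two conditions: (i) $a\cdot u=qu$, $\ b\cdot u=\gamma(q-q^{-1})1$, $\ c\cdot u=0$, $\ d\cdot u=q^{-1}u$; or (ii) $a\cdot u=q^{-1}u$, $\ b\cdot u=0$, $\ c\cdot u=\gamma^{-1}(q-q^{-1})u^2$, $\ d\cdot u=qu$. Conversely, by defining the action of $a,b,c,d$ by either (i) or (ii), the action of $u_q(\mathfrak{sl}_2)$ on $A$ extends to an action of $D(u_q(\mathfrak{sl}_2))$ making $A$ a $D(u_q(\mathfrak{sl}_2))$-module algebra.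
   Context: $\Bbbk$ is an algebraically closed field of characteristic $0$. For a Hopf algebra $H$, an $H$-module algebra is an algebra $A$ that is a left $H$-module with $h\cdot(ab)=(h_{(1)}\cdot a)(h_{(2)}\cdot b)$ and $h\cdot 1_A=\epsilon(h)1_A$. $u_q(\mathfrak{sl}_2)$ is the Hopf algebra generated by $K,E,F$ subject to $K^n=1$, $E^n=F^n=0$, $KE=q^2EK$, $KF=q^{-2}FK$, $EF-FE=\frac{K-K^{-1}}{q-q^{-1}}$, with $K$ grouplike, $\Delta(E)=1\otimes E+E\otimes K$, $\Delta(F)=K^{-1}\otimes F+F\otimes 1$. The Drinfel'd double $D(u_q(\mathfrak{sl}_2))$ is the Hopf algebra generated by $a,b,c,d,E,F,K$ subject to the relations $$K^n=1,\quad E^n=F^n=0,\quad KE=q^2EK,\quad KF=q^{-2}FK,\quad EF-FE=\frac{K-K^{-1}}{q-q^{-1}}$$ together with $$a^n=d^n=1,\quad b^n=c^n=0,\quad ba=qab,\quad db=qbd,\quad ca=qac,\quad dc=qcd,\quad bc=cb,\quad ad=q^{-1}bc+1,$$ $$Ka=aK,\quad Kb=q^{-2}bK,\quad Kc=q^2cK,\quad Kd=dK,$$ $$Ea=q^{-1}aE-q^{-1}c,\quad Eb=q^{-1}bE+q^{-1}aK-q^{-1}d,\quad Ec=qcE,\quad Ed=qdE+qcK,$$ $$Fa=q^{-1}aF+b,\quad Fb=qbF,\quad Fc=q^{-1}cF-aK^{-1}+d,\quad Fd=qdF-q^2bK^{-1}.$$ The coproduct on $K,E,F$ is that of $u_q(\mathfrak{sl}_2)$,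 and $\Delta(a)=a\otimes a+c\otimes b$, $\Delta(b)=b\otimes a+d\otimes b$, $\Delta(c)=a\otimes c+c\otimes d$, $\Delta(d)=b\otimes c+d\otimes d$; $\epsilon(a)=\epsilon(d)=\epsilon(K)=1$, $\epsilon(b)=\epsilon(c)=\epsilon(E)=\epsilon(F)=0$. An extension of the $u_q(\mathfrak{sl}_2)$-action is a $D(u_q(\mathfrak{sl}_2))$-action restricting to it. *)

(* Defs.v *)
From HB Require Import structures.
From mathcomp Require Import all_boot all_order all_algebra.

Set Implicit Arguments.
Unset Strict Implicit.
Unset Printing Implicit Defensive.

Import GRing.Theory.
Local Open Scope ring_scope.

(* An element of U (x) V is written as a finite sum of pure tensors, encoded as
   a sequence of pairs. Two such sums denote the same tensor iff no bilinear
   map separates them (universal property of the tensor product). *)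
Definition tensor_eq (k : fieldType) (U V : lmodType k) (s t : seq (U * V)) :=
  forall (W : lmodType k) (B : {bilinear U -> V -> W}),
    \sum_(p <- s) B p.1 p.2 = \sum_(p <- t) B p.1 p.2.

Definition trilinear (k : fieldType) (U W : lmodType k)
    (T : U -> U -> U -> W) : Prop :=
  [/\ forall y z, linear (fun x => T x y z),
      forall x z, linear (fun y => T x y z) &
      forall x y, linear (T x y)].

(* [coprod h] lists the pairs (h_(1), h_(2)) of a Sweedler representation of
   the coproduct of h; the choice of representative is irrelevant, all the
   axioms being stated in the tensor product. *)
Record hopfAlgebra (k : fieldType) := HopfAlgebra {
  hopf_alg :> algType k;
  coprod : hopf_alg -> seq (hopf_alg * hopf_alg);
  counit : {lrmorphism hopf_alg -> k | *%R};
  antipode : {linear hopf_alg -> hopf_alg};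
  coprodP : forall (c : k) (g h : hopf_alg),
    tensor_eq (coprod (c *: g + h))
              ([seq (c *: p.1, p.2) | p <- coprod g] ++ coprod h);
  coprod1 : tensor_eq (coprod 1) [:: (1, 1)];
  coprodM : forall g h : hopf_alg,
    tensor_eq (coprod (g * h))
              [seq (p.1 * r.1, p.2 * r.2) | p <- coprod g, r <- coprod h];
  coprodA : forall (h : hopf_alg) (W : lmodType k)
      (T : hopf_alg -> hopf_alg -> hopf_alg -> W), trilinear T ->
    \sum_(p <- coprod h) \sum_(r <- coprod p.1) T r.1 r.2 p.2 =
    \sum_(p <- coprod h) \sum_(r <- coprod p.2) T p.1 r.1 r.2;
  counitl : forall h : hopf_alg, \sum_(p <- coprod h) counit p.1 *: p.2 = h;
  counitr : forall h : hopf_alg, \sum_(p <- coprod h) counit p.2 *: p.1 = h;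
  antipodel : forall h : hopf_alg,
    \sum_(p <- coprod h) antipode p.1 * p.2 = counit h *: 1;
  antipoder : forall h : hopf_alg,
    \sum_(p <- coprod h) p.1 * antipode p.2 = counit h *: 1
}.

Definition is_module_algebra (k : fieldType) (H : hopfAlgebra k) (A : algType k)
    (act : H -> A -> A) : Prop :=
  [/\ bilinear_for *:%R *:%R act,
      (forall x, act 1 x = x) /\
      (forall g h x, act (g * h) x = act g (act h x)),
      forall h x y,
        act h (x * y) = \sum_(p <- coprod h) act p.1 x * act p.2 y &
      forall h, act h 1 = counit H h *: 1].

Definition is_subalgebra (k : fieldType) (H : algType k) (S : H -> Prop) : Prop :=
  [/\ S 1, forall (c : k) g h, S g -> S h -> S (c *: g + h) &
      forall g h, S g -> S h -> S (g * h)].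

(* H is the algebra generated by the g x, x : X, subject to the relations [rel]
   (a system of equations that makes sense in every k-algebra). *)
Definition presented_by (k : fieldType) (X : Type)
    (rel : forall B : algType k, (X -> B) -> Prop)
    (H : algType k) (g : X -> H) : Prop :=
  [/\ rel H g,
      forall S : H -> Prop, is_subalgebra S -> (forall x, S (g x)) ->
        forall h, S h &
      forall (B : algType k) (f : X -> B), rel B f ->
        exists phi : {lrmorphism H -> B}, forall x, phi (g x) = f x].

Inductive uq_gen := UK | UE | UF.

Inductive double_gen := DU of uq_gen | Da | Db | Dc | Dd.

(* As K ^ n = 1, the inverse of K is K ^ (n - 1). *)
Definition uq_rel (k : fieldType) (n : nat) (q : k) (B : algType k)
    (f : uq_gen -> B) : Prop :=
  let K := f UK in let E := f UE in let F := f UF in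
  let Kinv := K ^+ n.-1 in
  [/\ K ^+ n = 1, E ^+ n = 0 /\ F ^+ n = 0,
      K * E = q ^+ 2 *: (E * K), K * F = q ^- 2 *: (F * K) &
      E * F - F * E = (q - q^-1)^-1 *: (K - Kinv)].

Definition double_rel (k : fieldType) (n : nat) (q : k) (B : algType k)
    (f : double_gen -> B) : Prop :=
  let K := f (DU UK) in let E := f (DU UE) in let F := f (DU UF) in
  let Kinv := K ^+ n.-1 in
  let a := f Da in let b := f Db in let c := f Dc in let d := f Dd in
  uq_rel n q (fun x => f (DU x)) /\
  [/\ a ^+ n = 1, d ^+ n = 1, b ^+ n = 0 & c ^+ n = 0] /\
  [/\ b * a = q *: (a * b), d * b = q *: (b * d),
      c * a = q *: (a * c) & d * c = q *: (c * d)] /\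
  (b * c = c * b /\ a * d = q^-1 *: (b * c) + 1) /\
  [/\ K * a = a * K, K * b = q ^- 2 *: (b * K),
      K * c = q ^+ 2 *: (c * K) & K * d = d * K] /\
  [/\ E * a = q^-1 *: (a * E) - q^-1 *: c,
      E * b = q^-1 *: (b * E) + q^-1 *: (a * K) - q^-1 *: d,
      E * c = q *: (c * E) &
      E * d = q *: (d * E) + q *: (c * K)] /\
  [/\ F * a = q^-1 *: (a * F) + b,
      F * b = q *: (b * F),
      F * c = q^-1 *: (c * F) - a * Kinv + d &
      F * d = q *: (d * F) - q ^+ 2 *: (b * Kinv)].

(* Formulas common to u_q(sl_2) and to its double. *)
Definition uq_coalg (k : fieldType) (n : nat) (H : hopfAlgebra k)
    (f : uq_gen -> H) : Prop :=
  let K := f UK in let E := f UE in let F := f UF in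
  let Kinv := K ^+ n.-1 in
  [/\ tensor_eq (coprod K) [:: (K, K)],
      tensor_eq (coprod E) [:: (1, E); (E, K)] &
      tensor_eq (coprod F) [:: (Kinv, F); (F, 1)]] /\
  [/\ counit H K = 1, counit H E = 0 & counit H F = 0].

Definition is_uq_sl2 (k : fieldType) (n : nat) (q : k) (U : hopfAlgebra k)
    (x : uq_gen -> U) : Prop :=
  presented_by (@uq_rel k n q) x /\ uq_coalg n x.

Definition is_double_uq_sl2 (k : fieldType) (n : nat) (q : k)
    (D : hopfAlgebra k) (y : double_gen -> D) : Prop :=
  let a := y Da in let b := y Db in let c := y Dc in let d := y Dd in
  [/\ presented_by (@double_rel k n q) y,
      uq_coalg n (fun x => y (DU x)),
      [/\ tensor_eq (coprod a) [:: (a, a); (c, b)],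
          tensor_eq (coprod b) [:: (b, a); (d, b)],
          tensor_eq (coprod c) [:: (a, c); (c, d)] &
          tensor_eq (coprod d) [:: (b, c); (d, d)]] &
      [/\ counit D a = 1, counit D b = 0, counit D c = 0 & counit D d = 1]].

(* rhoD is a module algebra structure over D whose restriction along
   iota : U -> D is rhoU. *)
Definition is_extension (k : fieldType) (U D : hopfAlgebra k)
    (iota : U -> D) (A : algType k)
    (rhoU : U -> A -> A) (rhoD : D -> A -> A) : Prop :=
  is_module_algebra rhoD /\ forall h x, rhoD (iota h) x = rhoU h x.

(* {poly %/ p} is the quotient by p as soon as p is monic and not constant; here
   this means n > 0. *)
Definition cyclic_alg (k : fieldType) (n : nat) : algType k :=
  {poly %/ ('X^n - 1 : {poly k})}.

Definition cyclic_gen (k : fieldType) (n : nat) : cyclic_alg k n := 'qX.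

Definition action_i (k : fieldType) (n : nat) (q gamma : k) (D : hopfAlgebra k)
    (y : double_gen -> D) (rho : D -> cyclic_alg k n -> cyclic_alg k n) : Prop :=
  let u := cyclic_gen k n in
  [/\ rho (y Da) u = q *: u,
      rho (y Db) u = (gamma * (q - q^-1)) *: 1,
      rho (y Dc) u = 0 &
      rho (y Dd) u = q^-1 *: u].

Definition action_ii (k : fieldType) (n : nat) (q gamma : k) (D : hopfAlgebra k)
    (y : double_gen -> D) (rho : D -> cyclic_alg k n -> cyclic_alg k n) : Prop :=
  let u := cyclic_gen k n in
  [/\ rho (y Da) u = q^-1 *: u,
      rho (y Db) u = 0,
      rho (y Dc) u = (gamma^-1 * (q - q^-1)) *: u ^+ 2 &
      rho (y Dd) u = q *: u].

(* Main.v *)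
(* Converse: put L = K ^ ((n + 1) / 2), a grouplike square root of K (n is
   odd). Sending (a, b, c, d) to (L, (1 - q^-2) F L, 0, L^-1) or to
   (L^-1, 0, (q^-1 - q) E L^-1, L), and E, F, K to themselves, defines two
   retractions of the inclusion of u_q(sl_2) in its double which are compatible
   with the coproducts; pulling the given action back along them yields (i) and
   (ii).

   Uniqueness: a and d commute with K while b and c shift K-weights, and the
   K-weights q^(2i) of the u^i, i < n, are distinct, so a u = alpha u,
   d u = delta' u, b u = beta 1 and c u = kappa u^2. Applying the relations for
   Fa, Fc, Fd to u expresses beta, kappa, delta' through alpha, and the relation
   ad = q^-1 bc + 1 then becomes (alpha - q) (alpha - q^-1) = 0. *)
Require Import Defs.
From HB Require Import structures.
From mathcomp Require Import all_boot all_order all_algebra ring.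

Set Implicit Arguments.
Unset Strict Implicit.
Unset Printing Implicit Defensive.

Import GRing.Theory.
Local Open Scope ring_scope.

(** Each exchange of [y] and [x] costs a factor [s], so all factors [x] can be moved to the left.
    The scalar, a power of [s], stays implicit: the lemma serves to show that [F * l] and [E * m]
    inherit nilpotency from [F] and [E]. *)
Lemma exprM_qcomm (k : fieldType) (B : algType k) (s : k) (x y : B) m :
  y * x = s *: (x * y) -> exists t : k, (x * y) ^+ m = t *: (x ^+ m * y ^+ m).
Proof.
move=> yx.
have yxm j : y * x ^+ j = s ^+ j *: (x ^+ j * y).
  elim: j => [|j IHj]; first by rewrite !expr0 mulr1 mul1r scale1r.
  by rewrite !exprS mulrA yx -scalerAl -(mulrA x y) IHj -scalerAr scalerA mulrA.
elim: m => [|m [t IHm]]; first by exists 1; rewrite !expr0 mulr1 scale1r.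
exists (t * s ^+ m); rewrite !exprS IHm -scalerAr.
by rewrite -(mulrA x y) (mulrA y) yxm -scalerAl -scalerAr scalerA !mulrA.
Qed.

Definition double_fun (T : Type) (f : uq_gen -> T) (a b c d : T)
    (g : double_gen) : T :=
  match g with DU g => f g | Da => a | Db => b | Dc => c | Dd => d end.

(** * Relations of the double, given a square root [l] of [K] with inverse [m] *)

Section DoubleRelations.

Context (k : fieldType) (n : nat) (q : k) (B : algType k) (f : uq_gen -> B).
Context (n_gt0 : (0 < n)%N) (q_neq0 : q != 0) (q2_neq1 : q ^+ 2 != 1).
Context (fP : uq_rel n q f).

Local Notation K := (f UK).
Local Notation E := (f UE).
Local Notation F := (f UF).

Context (l m : B) (ll : l * l = K) (mm : m * m = K ^+ n.-1).
Context (lm : l * m = 1) (ml : m * l = 1) (ln : l ^+ n = 1) (mn : m ^+ n = 1).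
Context (lE : l * E = q *: (E * l)) (lF : l * F = q^-1 *: (F * l)).

Let mE : m * E = q^-1 *: (E * m).
Proof.
rewrite -[in RHS](mul1r E) -ml -(mulrA m) lE -!(scalerAl, scalerAr).
by rewrite scalerA mulVf // scale1r -!mulrA lm mulr1.
Qed.

Let mF : m * F = q *: (F * m).
Proof.
rewrite -[in RHS](mul1r F) -ml -(mulrA m) lF -!(scalerAl, scalerAr).
by rewrite scalerA mulfV // scale1r -!mulrA lm mulr1.
Qed.

Let EF : E * F = F * E + (q - q^-1)^-1 *: (l * l - m * m).
Proof. by rewrite ll mm; case: fP => _ _ _ _ <-; rewrite addrC subrK. Qed.

Let Fl_nil (s : k) : (s *: (F * l)) ^+ n = 0.
Proof.
have [t Fl] := exprM_qcomm n lF; have [_ [_ F0] _ _ _] := fP.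
by rewrite exprZn Fl F0 mul0r !scaler0.
Qed.

Let Em_nil (s : k) : (s *: (E * m)) ^+ n = 0.
Proof.
have [t Em] := exprM_qcomm n mE; have [_ [E0 _] _ _ _] := fP.
by rewrite exprZn Em E0 mul0r !scaler0.
Qed.

Let expr0_n : (0 : B) ^+ n = 0.
Proof. by rewrite expr0n; case: n n_gt0. Qed.

Let q_neqV : q * q - 1 != 0.
Proof. by rewrite subr_eq0. Qed.

(** In right-associated products, [u * v] is no longer a subterm of [u * (v * w)]; each commutation
    rule is therefore also needed in a form with a trailing factor. *)
Let tail (u v z : B) (t : k) :
  u * v = t *: z -> forall w, u * (v * w) = t *: (z * w).
Proof. by move=> e w; rewrite mulrA e -scalerAl. Qed.

Let lmw w : l * (m * w) = w. Proof. by rewrite mulrA lm mul1r. Qed.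
Let mlw w : m * (l * w) = w. Proof. by rewrite mulrA ml mul1r. Qed.
Let EFw w :
  E * (F * w) = F * (E * w) + (q - q^-1)^-1 *: ((l * l - m * m) * w).
Proof. by rewrite mulrA EF mulrDl -scalerAl mulrA. Qed.
Let mulZr (u v : B) t : u * (t *: v) = t *: (u * v).
Proof. by rewrite -scalerAr. Qed.
Let mulZl (u v : B) t : (t *: u) * v = t *: (u * v).
Proof. by rewrite -scalerAl. Qed.
Let scaleN (u : B) (t : k) : t *: (- u) = (- t) *: u.
Proof. by rewrite scalerN scaleNr. Qed.
Let mulA_r (u v w : B) : u * v * w = u * (v * w).
Proof. by rewrite mulrA. Qed.

(* Rewriting to the PBW-type normal form [F ^ i E ^ j l ^ r], [r] an integer. *)
Let pbw := (mulr1, mul1r, mulA_r,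
  (tail lE, tail lF, tail mE, tail mF, lmw, mlw, EFw), (lE, lF, mE, mF, lm, ml, EF),
  (mulZr, mulZl, scalerA, scalerDr), (mulrDl, mulrDr, mulrN, mulNr, scaleN)).

Lemma double_rel_i :
  double_rel n q (double_fun f l ((1 - q ^- 2) *: (F * l)) 0 m).
Proof.
(* [K] and its inverse [K ^+ n.-1] become [l * l] and [m * m], so that one normal form serves all
   the relations. *)
rewrite /double_rel /= -mm; split=> //.
rewrite -ll ?(mul0r, mulr0, scaler0, addr0, subr0, add0r) !pbw.
do ![split=> //].
- by congr (_ *: _); field; rewrite ?q_neq0.
- by congr (_ *: _); field; rewrite ?q_neq0.
- by congr (_ *: _); field; rewrite ?q_neq0.
- by rewrite mulVf // scale1r.
(* Relation for [E b]: since (1 - q^-2) / (q - q^-1) = q^-1, the commutator of [E] and [F]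
   contributes exactly q^-1 (aK - d). This fixes the coefficient of [F * l]. *)
- by rewrite scaleNr -addrA; congr (_ *: _ + (_ *: _ - _ *: _));
    field; rewrite ?q_neq0 ?q_neqV.
- by rewrite mulfV // scale1r.
- by rewrite -scalerDl -[LHS]scale1r; congr (_ *: _); field; rewrite ?q_neq0.
- by congr (_ *: _); field; rewrite ?q_neq0.
- by rewrite addNr.
- by rewrite -scalerBl -[LHS]scale1r; congr (_ *: _); field; rewrite ?q_neq0.
Qed.

Lemma double_rel_ii :
  double_rel n q (double_fun f m 0 ((q^-1 - q) *: (E * m)) l).
Proof.
rewrite /double_rel /= -mm; split=> //.
rewrite -ll ?(mul0r, mulr0, scaler0, addr0, subr0, add0r) !pbw.
do ![split=> //].
- by congr (_ *: _); field; rewrite ?q_neq0.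
- by congr (_ *: _); field; rewrite ?q_neq0.
- by congr (_ *: _); field; rewrite ?q_neq0.
- by rewrite -scalerBl -[LHS]scale1r; congr (_ *: _); field; rewrite ?q_neq0.
- by rewrite subrr.
- by congr (_ *: _); field; rewrite ?q_neq0.
- by rewrite -scalerDl -[LHS]scale1r; congr (_ *: _); field; rewrite ?q_neq0.
- by rewrite mulVf // scale1r.
(* Relation for [F c]: the coefficient q^-1 - q turns the commutator of [E] and [F] into -(l - m^3),
   which cancels -aK^-1 + d. *)
- rewrite -(addrA _ _ l) -addrA (_ : _ / (q - q^-1) - _ = -1).
    rewrite opprK scaleN1r scale1r (addrA (- l + _)) addrK addNr addr0.
    by congr (_ *: _); field; rewrite ?q_neq0.
  by field; rewrite ?q_neq0 ?q_neqV.
- by rewrite mulfV // scale1r.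
Qed.

End DoubleRelations.

(** * Powers of [K] as its square root and the inverse of that root *)

Section SquareRoots.

Context (k : fieldType) (n : nat) (q : k) (B : algType k) (f : uq_gen -> B).
Context (n_odd : odd n) (qn : q ^+ n = 1) (fP : uq_rel n q f).

Local Notation K := (f UK).
Local Notation E := (f UE).
Local Notation F := (f UF).
Local Notation L := (K ^+ n./2.+1).
Local Notation M := (K ^+ n./2).

Let n_half : (n = n./2.*2.+1)%N.
Proof. by rewrite -[LHS]odd_double_half n_odd. Qed.

(** As n is odd, the exponents of [L] and [M] are (n + 1)/2 and (n - 1)/2. They add up to n, and
    doubling the second gives n - 1, the exponent representing K^-1. *)
Lemma uq_MM : M * M = K ^+ n.-1.
Proof. by rewrite -exprD addnn [in RHS]n_half. Qed.

Lemma uq_LM : L * M = 1.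
Proof. by rewrite -exprD addSn addnn -n_half; case: fP. Qed.

Lemma uq_ML : M * L = 1.
Proof. by rewrite -uq_LM -!exprD addnC. Qed.

Lemma uq_LL : L * L = K.
Proof. by rewrite {1}exprS -mulrA uq_ML mulr1. Qed.

(** (n + 1)/2 inverts 2 modulo n, so passing from [K] to [L] replaces the weight q^2 by q. *)
Lemma uq_sqrt_expr : (q ^+ 2) ^+ n./2.+1 = q.
Proof.
rewrite -exprM mulnS mul2n -[RHS]mulr1 -[in RHS]qn -exprS.
by congr (_ ^+ _); rewrite [in RHS]n_half.
Qed.

Lemma uq_LE : L * E = q *: (E * L).
Proof.
have KE : K * E = q ^+ 2 *: (E * K) by case: fP.
(* Writing q as (q^2)^((n+1)/2) puts the same exponent on both sides, which can then be generalized
   and treated by induction. *)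
rewrite -[in RHS]uq_sqrt_expr; elim: _.+1 => [|m IHm].
  by rewrite !expr0 mul1r mulr1 scale1r.
by rewrite !(exprSr K) exprS -mulrA KE -scalerAr (mulrA (K ^+ m)) IHm
  -scalerAl scalerA mulrA.
Qed.

Lemma uq_LF : L * F = q^-1 *: (F * L).
Proof.
have KF : K * F = q ^- 2 *: (F * K) by case: fP.
rewrite -[in RHS]uq_sqrt_expr; elim: _.+1 => [|m IHm].
  by rewrite !expr0 invr1 mul1r mulr1 scale1r.
by rewrite !(exprSr K) exprS invfM -mulrA KF -scalerAr (mulrA (K ^+ m)) IHm
  -scalerAl scalerA mulrA.
Qed.

Lemma uq_K_expn j : (K ^+ j) ^+ n = 1.
Proof. by rewrite exprAC; case: fP => -> *; rewrite expr1n. Qed.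

Context (n_gt0 : (0 < n)%N) (q_neq0 : q != 0) (q2_neq1 : q ^+ 2 != 1).

Lemma uq_double_rel_i :
  double_rel n q (double_fun f L ((1 - q ^- 2) *: (F * L)) 0 M).
Proof.
exact: (double_rel_i n_gt0 q_neq0 q2_neq1 fP uq_LL uq_MM uq_LM uq_ML
  (uq_K_expn _) (uq_K_expn _) uq_LE uq_LF).
Qed.

Lemma uq_double_rel_ii :
  double_rel n q (double_fun f M 0 ((q^-1 - q) *: (E * M)) L).
Proof.
exact: (double_rel_ii n_gt0 q_neq0 q2_neq1 fP uq_LL uq_MM uq_LM uq_ML
  (uq_K_expn _) (uq_K_expn _) uq_LE uq_LF).
Qed.

End SquareRoots.

(** * Module algebras: reduction to generators *)

Lemma tensor_eq_bilinear (k : fieldType) (U V W : lmodType k)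
    (s t : seq (U * V)) (B : U -> V -> W) :
  bilinear_for *:%R *:%R B -> tensor_eq s t ->
  \sum_(p <- s) B p.1 p.2 = \sum_(p <- t) B p.1 p.2.
Proof.
move=> Bbil st.
(* [tensor_eq] quantifies over bundled bilinear maps, so [B] has to be bundled first. *)
pose B' : {bilinear U -> V -> W} :=
  HB.pack B (bilinear_isBilinear.Build k U V W *:%R *:%R B Bbil).
exact: (st _ B').
Qed.

Section ModuleAlgebras.

Context (k : fieldType) (H : hopfAlgebra k) (A : algType k).

Section Bilinear.

Context (act : H -> A -> A) (act_bilin : bilinear_for *:%R *:%R act).

Lemma act_linl (c : k) g h z : act (c *: g + h) z = c *: act g z + act h z.
Proof. exact: (act_bilin.1 z). Qed.

Lemma act_linr h (c : k) z w : act h (c *: z + w) = c *: act h z + act h w.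
Proof. exact: (act_bilin.2 h). Qed.

Lemma act0l z : act 0 z = 0.
Proof. by rewrite -[0 in LHS](addNr 0) -scaleN1r act_linl scaleN1r addNr. Qed.

Lemma act0r h : act h 0 = 0.
Proof. by rewrite -[0 in LHS](addNr 0) -scaleN1r act_linr scaleN1r addNr. Qed.

Lemma actZl c h z : act (c *: h) z = c *: act h z.
Proof. by rewrite -[c *: h]addr0 act_linl act0l addr0. Qed.

Lemma actZr h c z : act h (c *: z) = c *: act h z.
Proof. by rewrite -[c *: z]addr0 act_linr act0r addr0. Qed.

Lemma actDl g h z : act (g + h) z = act g z + act h z.
Proof. by rewrite -[g]scale1r act_linl !scale1r. Qed.

Lemma actDr h z w : act h (z + w) = act h z + act h w.
Proof. by rewrite -[z]scale1r act_linr !scale1r. Qed.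

Lemma act_sumr (I : Type) (r : seq I) h (z : I -> A) :
  act h (\sum_(i <- r) z i) = \sum_(i <- r) act h (z i).
Proof. exact: (big_morph _ (actDr h) (act0r h)). Qed.

Lemma act_mul_bilinear z w :
  bilinear_for *:%R *:%R (fun g h => act g z * act h w).
Proof.
split=> h c h1 h2 /=; rewrite act_linl.
  by rewrite mulrDl -scalerAl.
by rewrite mulrDr -scalerAr.
Qed.

Lemma act_tensor_eq (s t : seq (H * H)) z w : tensor_eq s t ->
  \sum_(p <- s) act p.1 z * act p.2 w = \sum_(p <- t) act p.1 z * act p.2 w.
Proof. exact: (tensor_eq_bilinear (act_mul_bilinear z w)). Qed.

End Bilinear.

(** The elements satisfying the product rule form a subalgebra because the coproduct is linear and
    multiplicative; the same holds for the unit rule and the counit. *)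
Lemma module_algebra_of_gen (X : Type) (g : X -> H) (act : H -> A -> A) :
    (forall S : H -> Prop, is_subalgebra S -> (forall i, S (g i)) ->
      forall h, S h) ->
    bilinear_for *:%R *:%R act -> (forall z, act 1 z = z) ->
    (forall h1 h2 z, act (h1 * h2) z = act h1 (act h2 z)) ->
    (forall i z w, act (g i) (z * w) =
      \sum_(p <- coprod (g i)) act p.1 z * act p.2 w) ->
    (forall i, act (g i) 1 = counit H (g i) *: 1) ->
  is_module_algebra act.
Proof.
move=> gen bil act1 actM actG actG1; split=> //.
  apply: gen => //; split.
  - move=> z w.
    by rewrite act1 (act_tensor_eq bil _ _ (@coprod1 _ H)) big_seq1 /= !act1.
  - move=> c h1 h2 IH1 IH2 z w.
    rewrite (act_tensor_eq bil _ _ (@coprodP _ H c h1 h2)) big_cat big_map /=.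
    rewrite act_linl // IH1 IH2 scaler_sumr; congr (_ + _).
    by apply: eq_bigr => p _; rewrite actZl // scalerAl.
  move=> h1 h2 IH1 IH2 z w.
  (* Acting by [h2] and then by [h1] sums over the coproduct of [h2] outermost, the opposite of the
     order in [coprodM]; hence the exchange of sums. *)
  rewrite (act_tensor_eq bil _ _ (@coprodM _ H h1 h2)) big_allpairs_dep /=.
  rewrite actM IH2 act_sumr // exchange_big /=; apply: eq_bigr => p _.
  by rewrite IH1; apply: eq_bigr => r _; rewrite !actM.
apply: gen => //; split.
- by rewrite act1 rmorph1 scale1r.
- by move=> c h1 h2 IH1 IH2; rewrite act_linl // IH1 IH2 linearP scalerDl scalerA.
by move=> h1 h2 IH1 IH2; rewrite actM IH2 actZr // IH1 rmorphM mulrC scalerA.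
Qed.

Section ActMul.

Context (act : H -> A -> A) (actP : is_module_algebra act).

Lemma act_mul h (s : seq (H * H)) z w : tensor_eq (coprod h) s ->
  act h (z * w) = \sum_(p <- s) act p.1 z * act p.2 w.
Proof.
by case: actP => bil _ actX _ hs; rewrite actX; apply: act_tensor_eq.
Qed.

End ActMul.

Lemma module_algebra_eq (X : Type) (g : X -> H) (act act' : H -> A -> A) :
    (forall S : H -> Prop, is_subalgebra S -> (forall i, S (g i)) ->
      forall h, S h) ->
    is_module_algebra act -> is_module_algebra act' ->
    (forall i z, act' (g i) z = act (g i) z) ->
  forall h z, act' h z = act h z.
Proof.
move=> gen [bil [act1 actM] _ _] [bil' [act1' actM'] _ _] eqG.
apply: gen => //; split.
- by move=> z; rewrite act1 act1'.
- by move=> c h1 h2 IH1 IH2 z; rewrite !act_linl // IH1 IH2.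
by move=> h1 h2 IH1 IH2 z; rewrite actM actM' IH2 IH1.
Qed.

End ModuleAlgebras.

(** * The basis 1, u, ..., u^(n-1) of the cyclic algebra *)

Section CyclicAlgebra.

Context (k : fieldType) (n : nat) (n_gt1 : (1 < n)%N).

Local Notation A := (cyclic_alg k n).
Local Notation u := (cyclic_gen k n).

Let mk_monicE : mk_monic ('X^n - 1 : {poly k}) = 'X^n - 1.
Proof.
have n_gt0 := ltnW n_gt1.
by rewrite /mk_monic size_XnsubC // ltnS n_gt0 monicXnsubC.
Qed.

Lemma cyclic_gen_exp i : u ^+ i = in_qpoly ('X^n - 1) 'X^i.
Proof. by rewrite rmorphXn. Qed.

Lemma cyclic_gen_exp_val i : (i < n)%N -> val (u ^+ i) = 'X^i.
Proof.
move=> lt_in; rewrite cyclic_gen_exp [LHS]in_qpoly_small //.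
by rewrite mk_monicE size_XnsubC ?size_polyXn ?ltnS ?(ltnW n_gt1).
Qed.

Lemma cyclic_coef_sum (t : nat -> k) j :
  (val (\sum_(i < n) t i *: u ^+ i : A))`_j = if (j < n)%N then t j else 0.
Proof.
rewrite raddf_sum /= coef_sum.
rewrite (eq_bigr (fun i : 'I_n => t i *+ (j == i))) => [|i _]; last first.
  by rewrite coefZ -/(val _) cyclic_gen_exp_val // coefXn mulr_natr.
case: ltnP => [ltjn|lenj].
  rewrite (bigD1 (Ordinal ltjn)) //= eqxx big1 ?addr0 // => i.
  by rewrite -val_eqE eq_sym => /= /negPf->.
by rewrite big1 // => i _; rewrite gtn_eqF // (leq_trans (ltn_ord i)).
Qed.

Lemma cyclic_sum (z : A) : z = \sum_(i < n) (val z)`_i *: u ^+ i.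
Proof.
apply/val_inj/polyP => j; rewrite cyclic_coef_sum.
case: ltnP => // lenj; rewrite nth_default //.
have sz : size (mk_monic ('X^n - 1 : {poly k})) = n.+1.
  by rewrite mk_monicE size_XnsubC // ltnW.
by apply: leq_trans lenj; rewrite -ltnS -sz; apply: size_mk_monic.
Qed.

(** The eigenvalues t^i, i < n, are distinct because [t] is primitive, so each eigenspace is a line.
    Comparing coefficients of [T z] kills all but the [j]-th one. *)
Lemma cyclic_eigen (T : A -> A) (t : k) (j : nat) (z : A) :
    n.-primitive_root t -> (forall c v w, T (c *: v + w) = c *: T v + T w) ->
    (forall i, T (u ^+ i) = t ^+ i *: u ^+ i) -> (j < n)%N ->
    T z = t ^+ j *: z ->
  exists s, z = s *: u ^+ j.
Proof.
move=> t_prim T_lin Tu ltjn Tz; exists (val z)`_j.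
have T0 : T 0 = 0 by rewrite -[0 in LHS](addNr 0) -scaleN1r T_lin scaleN1r addNr.
have TD v w : T (v + w) = T v + T w by rewrite -[v]scale1r T_lin !scale1r.
have TZ c v : T (c *: v) = c *: T v by rewrite -[c *: v]addr0 T_lin T0 addr0.
have TzE : T z = \sum_(i < n) ((val z)`_i * t ^+ i) *: u ^+ i.
  rewrite [in LHS](cyclic_sum z) (big_morph T TD T0); apply: eq_bigr => i _.
  by rewrite TZ Tu scalerA.
rewrite [LHS]cyclic_sum (bigD1 (Ordinal ltjn)) //= big1 ?addr0 // => i.
rewrite -val_eqE /= => neq_ij.
have /eqP : (val (T z))`_i = (val (t ^+ j *: z))`_i by rewrite Tz.
rewrite TzE (cyclic_coef_sum (fun i => (val z)`_i * t ^+ i)) ltn_ord coefZ.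
rewrite mulrC -subr_eq0 -mulrBl mulf_eq0.
rewrite subr_eq0 (eq_prim_root_expr t_prim) !modn_small // (negPf neq_ij) /=.
by move=> /eqP->; rewrite scale0r.
Qed.

Lemma cyclic_ind (S : A -> Prop) : is_subalgebra S -> S u -> forall z, S z.
Proof.
move=> [S1 Sl SM] Su z.
have S0 : S 0 by rewrite -(addNr (1 : A)) -scaleN1r; apply: Sl.
rewrite (cyclic_sum z); apply: (big_ind S) => // [v w Sv Sw|i _].
  by rewrite -[v]scale1r; apply: Sl.
rewrite -[_ *: _]addr0; apply: Sl => //.
by elim: (val i) => [|j IHj]; rewrite ?expr0 // exprS; apply: SM.
Qed.

Lemma cyclic_scale_exp_inj i (s t : k) : (i < n)%N ->
  s *: u ^+ i = t *: u ^+ i :> A -> s = t.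
Proof.
move=> lt_in /(congr1 (fun z : A => (val z)`_i)) /=.
by rewrite !coefZ -/(val _) cyclic_gen_exp_val // coefXn eqxx !mulr1.
Qed.

End CyclicAlgebra.

(** * Nonvanishing facts about q *)

Section RootOfUnity.

Context (k : fieldType) (n : nat) (n_ge3 : (3 <= n)%N) (n_odd : odd n).
Context (q : k) (q_prim : n.-primitive_root q).

Lemma prim_root_neq0 : q != 0.
Proof.
apply: contraTneq n_ge3 => q0; have /eqP := prim_expr_order q_prim.
by rewrite q0 expr0n; case: n => [|m] //=; rewrite eq_sym oner_eq0.
Qed.

Lemma prim_root_sqr : n.-primitive_root (q ^+ 2).
Proof. by rewrite prim_root_exp_coprime // coprime_sym coprimen2. Qed.

Lemma prim_root_sqr_neq1 : q ^+ 2 != 1.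
Proof. by rewrite -(prim_order_dvd q_prim) gtnNdvd. Qed.

(** If q^2 = -1, then the order n of q^2 would divide 2. Since F u^2 = gamma (1 + q^-2) u, this is
    what allows the coefficient of c u to be solved for. *)
Lemma prim_root_1Dsqr_neq0 : 1 + q ^+ 2 != 0.
Proof.
apply: contraTneq isT => /eqP; rewrite addrC addr_eq0 => /eqP q2.
have : (n %| 2)%N by rewrite (prim_order_dvd prim_root_sqr) q2 sqrrN expr1n.
by rewrite gtnNdvd.
Qed.

End RootOfUnity.

(** * Every extension is of type (i) or (ii) *)

Section Forward.

Context (k : fieldType) (n : nat) (n_ge3 : (3 <= n)%N) (n_odd : odd n).
Context (q : k) (q_prim : n.-primitive_root q).
Context (D : hopfAlgebra k) (y : double_gen -> D) (DP : is_double_uq_sl2 n q y).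
Context (gamma delta : k) (gamma_delta : gamma * delta = - q).
Context (act : D -> cyclic_alg k n -> cyclic_alg k n).
Context (actP : is_module_algebra act).

Local Notation u := (cyclic_gen k n).
Local Notation a := (y Da).
Local Notation b := (y Db).
Local Notation c := (y Dc).
Local Notation d := (y Dd).
Local Notation K := (y (DU UK)).
Local Notation F := (y (DU UF)).
Context (actK : act K u = q ^+ 2 *: u) (actF : act F u = gamma *: 1).

Lemma extension_cases : action_i q gamma y act \/ action_ii q gamma y act.
Proof.
have n_gt1 : (1 < n)%N by apply: leq_trans n_ge3.
have [bil [act1 actM] _ actX1] := actP.
have [[rel _ _] [[cK _ cF] [eK _ _]] [ca cb cc cd] [ea eb ec ed]] := DP.
have [_ [_ [_ [[_ relad] [[relKa relKb relKc relKd] [_ relF]]]]]] := rel.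
have [relFa _ relFc relFd] := relF.
have q0 := prim_root_neq0 n_ge3 q_prim.
have q4 := prim_root_1Dsqr_neq0 n_ge3 n_odd q_prim.
have q2n : q ^+ 2 * (q ^+ 2) ^+ n.-1 = 1.
  rewrite -exprS prednK ?(ltnW n_gt1) //.
  exact: (prim_expr_order (prim_root_sqr n_odd q_prim)).
have mulK z w : act K (z * w) = act K z * act K w.
  by rewrite (act_mul actP _ _ cK) big_seq1.
have Kexp i : act K (u ^+ i) = (q ^+ 2) ^+ i *: u ^+ i.
  elim: i => [|i IHi]; first by rewrite !expr0 actX1 eK.
  by rewrite (exprS u) (exprS (q ^+ 2)) mulK actK IHi -scalerAl -scalerAr scalerA.
have Kinv i : act (K ^+ i) u = (q ^+ 2) ^+ i *: u.
  elim: i => [|i IHi]; first by rewrite !expr0 scale1r act1.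
  by rewrite exprS (exprS (q ^+ 2)) actM IHi actZr // actK scalerA mulrC.
have eigen j z : (j < n)%N -> act K z = (q ^+ 2) ^+ j *: z ->
    exists s, z = s *: u ^+ j.
  apply: (cyclic_eigen n_gt1 (prim_root_sqr n_odd q_prim)) => //.
  by move=> *; apply: act_linr.
(* The commutation rules with [K] give a u, d u, b u and c u the [K]-weights q^2, q^2, 1 and q^4,
   those of u, u, 1 and u^2. For the last, 2 < n is needed. *)
have [al au] : exists s, act a u = s *: u.
  apply: (@eigen 1%N) => //.
  by rewrite -actM relKa actM actK actZr.
have [dl du] : exists s, act d u = s *: u.
  apply: (@eigen 1%N) => //.
  by rewrite -actM relKd actM actK actZr.
have [be bu] : exists s, act b u = s *: 1.
  apply: (@eigen 0%N) => //; first exact: ltnW.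
  by rewrite -actM relKb actZl // actM actK actZr // scalerA mulVf ?expf_neq0.
have [ka cu] : exists s, act c u = s *: u ^+ 2.
  apply: (@eigen 2) => //.
  by rewrite -actM relKc actZl // actM actK actZr // scalerA -expr2.
have uu (s t : k) : s *: (u * u) = t *: (u * u) -> s = t.
  exact: (@cyclic_scale_exp_inj _ _ n_gt1 2).
have u1 (s t : k) : s *: u = t *: u -> s = t.
  exact: (@cyclic_scale_exp_inj _ _ n_gt1 1).
have u0 (s t : k) : s *: (1 : cyclic_alg k n) = t *: 1 -> s = t.
  by apply: (@cyclic_scale_exp_inj _ _ n_gt1 0); apply: ltnW.
rewrite expr2 in cu.
have Vu : act (K ^+ n.-1) u = q ^- 2 *: u.
  by rewrite Kinv; congr (_ *: _); rewrite -[LHS](mulKf (expf_neq0 2 q0)) q2n mulr1.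
(* Applied to u, the relations for [ad] and [Fc] involve b (c u) and F (c u), hence [b] and [F] on
   u^2. *)
have buu : act b (u * u) = (be * (al + dl)) *: u.
  rewrite (act_mul actP _ _ cb) big_cons big_seq1 /= au bu du.
  rewrite -!(scalerAl, scalerAr) mulr1 mul1r !scalerA -scalerDl.
  by congr (_ *: _); ring.
have Fuu : act F (u * u) = (gamma * (1 + q ^- 2)) *: u.
  rewrite (act_mul actP _ _ cF) big_cons big_seq1 /= actF Vu act1.
  rewrite -!(scalerAl, scalerAr) mulr1 mul1r !scalerA -scalerDl.
  by congr (_ *: _); field.
have [a1 b1 c1 d1] : [/\ act a 1 = 1, act b 1 = 0, act c 1 = 0 & act d 1 = 1].
  by rewrite !actX1 ea eb ec ed !scale1r !scale0r.
have actN h z : act (- h) z = - act h z by rewrite -scaleN1r actZl // scaleN1r.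
have actE' := (actDl bil, actN, actZl bil, actM, actZr bil).
(* The relations for [Fa], [Fd], [Fc] and [ad] are now evaluated at u; each is an identity between
   multiples of 1 or of u, hence between scalars. *)
have eqFa : al * gamma = q^-1 * gamma + be.
  apply: u0; have := congr1 (act^~ u) relFa.
  by rewrite /= !actE' au actF bu !actE' actF a1 !scalerA scalerDl.
have eqFd : dl * gamma = q * gamma - be.
  apply: u0; have := congr1 (act^~ u) relFd.
  rewrite /= !actE' du actF Vu !actE' actF bu d1 !scalerA scalerBl => ->.
  by rewrite mulfV ?mul1r ?expf_neq0.
have eqFc : ka * (gamma * (1 + q ^- 2)) = dl - q ^- 2 * al.
  apply: u1; have := congr1 (act^~ u) relFc.
  rewrite /= !actE' cu actF Vu !actE' Fuu c1 au du !scalerA scaler0 add0r => ->.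
  by rewrite scalerBl [LHS]addrC.
have eqad : dl * al = q^-1 * ka * (be * (al + dl)) + 1.
  apply: u1; have := congr1 (act^~ u) relad.
  by rewrite /= !actE' du cu act1 !actE' au buu !scalerA scalerDl scale1r.
have g0 : gamma != 0.
  by apply: contra_eq_neq gamma_delta => ->; rewrite mul0r eq_sym oppr_eq0.
have beE : be = gamma * (al - q^-1) by rewrite mulrBr (mulrC gamma) eqFa; ring.
have dlE : dl = q + q^-1 - al.
  by apply: (mulIf g0); rewrite eqFd beE; ring.
have kaE : ka = gamma^-1 * (q - al).
  have q20 : gamma * (1 + q ^- 2) != 0.
    rewrite mulf_neq0 //; apply: contraNneq q4 => e.
    by rewrite -(mulr0 (q ^+ 2)) -e; apply/eqP; field.
  by apply: (mulIf q20); rewrite eqFc dlE; field; rewrite ?g0 ?q0.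
(* Put P = (q - al)(al - q^-1). Substitution gives dl al - 1 = P, while the [bc] term equals (1 +
   q^-2) P since al + dl = q + q^-1. The difference is -q^-2 P, whence the factor q^2. *)
have /eqP : (al - q) * (al - q^-1) = 0.
  have : q ^+ 2 * (dl * al - (q^-1 * ka * (be * (al + dl)) + 1)) = 0.
    by rewrite eqad subrr mulr0.
  by rewrite beE dlE kaE => <-; field; rewrite ?g0 ?q0.
rewrite mulf_eq0 !subr_eq0 => /orP[] /eqP alE; [left|right].
  split; rewrite ?au ?bu ?cu ?du ?beE ?kaE ?dlE alE //.
  - by rewrite subrr mulr0 scale0r.
  by congr (_ *: _); ring.
split; rewrite ?au ?bu ?cu ?du ?beE ?kaE ?dlE alE //.
- by rewrite subrr mulr0 scale0r.
by congr (_ *: _); ring.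
Qed.

End Forward.

(** * Extensions by pullback, and their determination by values on u *)

Section Extensions.

Context (k : fieldType) (n : nat) (q : k).
Context (U : hopfAlgebra k) (x : uq_gen -> U) (UP : is_uq_sl2 n q x).
Context (D : hopfAlgebra k) (y : double_gen -> D) (DP : is_double_uq_sl2 n q y).
Context (iota : {lrmorphism U -> D}) (iotaP : forall g, iota (x g) = y (DU g)).

Section Pullback.

Context (A : algType k) (rho : U -> A -> A) (rhoP : is_module_algebra rho).
Context (a b c d : U) (rel : double_rel n q (double_fun x a b c d)).
Context (rho_a : forall z w, rho a (z * w) = rho a z * rho a w + rho c z * rho b w).
Context (rho_b : forall z w, rho b (z * w) = rho b z * rho a w + rho d z * rho b w).
Context (rho_c : forall z w, rho c (z * w) = rho a z * rho c w + rho c z * rho d w).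
Context (rho_d : forall z w, rho d (z * w) = rho b z * rho c w + rho d z * rho d w).
Context (rho_a1 : rho a 1 = 1) (rho_b1 : rho b 1 = 0) (rho_c1 : rho c 1 = 0).
Context (rho_d1 : rho d 1 = 1).

(** The presentation of [D] yields a homomorphism [phi] to [U], along which [rho] is pulled back.
    The product rules for a, b, c, d are assumed on [A] through [rho], so [phi] need not be shown to
    respect coproducts. *)
Lemma extension_exists : exists rhoD : D -> A -> A,
  is_extension iota rho rhoD /\
  [/\ rhoD (y Da) =1 rho a, rhoD (y Db) =1 rho b, rhoD (y Dc) =1 rho c &
      rhoD (y Dd) =1 rho d].
Proof.
have [[_ genD univ] [[DK DE DF] [eK eE eF]] [Dca Dcb Dcc Dcd] [ea eb ec ed]] := DP.
have [phi phiP] := univ U _ rel.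
have phiU g : phi (y (DU g)) = x g by rewrite phiP.
have [pa pb pc pd] :
    [/\ phi (y Da) = a, phi (y Db) = b, phi (y Dc) = c & phi (y Dd) = d].
  by rewrite !phiP.
have [[_ genU _] [[UcK UcE UcF] [ueK ueE ueF]]] := UP.
have [bil [rho1 rhoM] rhoX rhoX1] := rhoP.
exists (fun h => rho (phi h)); split; last by split=> z; rewrite phiP.
have bil' : bilinear_for *:%R *:%R (fun h : D => rho (phi h)).
  split=> [z|h] s v w; first by rewrite /= linearP act_linl.
  by rewrite act_linr.
split.
  apply: (module_algebra_of_gen genD) => //.
  - by move=> z; rewrite rmorph1.
  - by move=> h1 h2 z; rewrite rmorphM rhoM.
  - case=> [[]|||| ] z w; rewrite phiP /=.
    + by rewrite (act_tensor_eq bil' _ _ DK) (act_mul rhoP _ _ UcK) !big_seq1 /= phiU.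
    + rewrite (act_tensor_eq bil' _ _ DE) (act_mul rhoP _ _ UcE).
      by rewrite !big_cons !big_nil /= rmorph1 !phiU.
    + rewrite (act_tensor_eq bil' _ _ DF) (act_mul rhoP _ _ UcF).
      by rewrite !big_cons !big_nil /= rmorph1 rmorphXn /= !phiU.
    + by rewrite (act_tensor_eq bil' _ _ Dca) big_cons big_seq1 /= pa pb pc.
    + by rewrite (act_tensor_eq bil' _ _ Dcb) big_cons big_seq1 /= pa pb pd.
    + by rewrite (act_tensor_eq bil' _ _ Dcc) big_cons big_seq1 /= pa pc pd.
    + by rewrite (act_tensor_eq bil' _ _ Dcd) big_cons big_seq1 /= pb pc pd.
  by case=> [[]|||| ]; rewrite phiP /= ?(rho_a1, rho_b1, rho_c1, rho_d1)
    ?(ea, eb, ec, ed) ?scale1r ?scale0r // rhoX1 ?(ueK, ueE, ueF) ?(eK, eE, eF).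
(* [phi] is a retraction of [iota]: their composite fixes the generators of [U], hence
   everything. *)
move=> h z; congr (rho _ z); apply: (genU (fun h => phi (iota h) = h)); last first.
  by move=> g; rewrite iotaP phiU.
split; first by rewrite !rmorph1.
  by move=> s h1 h2 e1 e2; rewrite !linearP /= e1 e2.
by move=> h1 h2 e1 e2; rewrite !rmorphM /= e1 e2.
Qed.

End Pullback.

(** The coproducts of a, b, c, d involve only these four elements, so agreement of all four together
    passes to products, and u generates the algebra. *)
Lemma extension_unique (n_gt1 : (1 < n)%N)
    (rho : U -> cyclic_alg k n -> cyclic_alg k n)
    (act act' : D -> cyclic_alg k n -> cyclic_alg k n) :
    is_extension iota rho act -> is_extension iota rho act' ->
    let u := cyclic_gen k n in
    [/\ act' (y Da) u = act (y Da) u, act' (y Db) u = act (y Db) u,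
        act' (y Dc) u = act (y Dc) u & act' (y Dd) u = act (y Dd) u] ->
  forall h z, act' h z = act h z.
Proof.
move=> [actP actU] [actP' actU'] u eq_u.
have [[_ genD _] _ [ca cb cc cd] [ea eb ec ed]] := DP.
have [bil _ _ actX1] := actP; have [bil' _ _ actX1'] := actP'.
pose agree z := [/\ act' (y Da) z = act (y Da) z, act' (y Db) z = act (y Db) z,
  act' (y Dc) z = act (y Dc) z & act' (y Dd) z = act (y Dd) z].
have agreeA z : agree z.
  apply: (cyclic_ind n_gt1 (S := agree)); last by [].
  split; first by split; rewrite actX1 actX1'.
    move=> s v w [av bv cv dv] [aw bw cw dw].
    by split; rewrite !act_linr // ?(av, bv, cv, dv) ?(aw, bw, cw, dw).
  move=> v w [av bv cv dv] [aw bw cw dw].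
  split.
  - by rewrite (act_mul actP _ _ ca) (act_mul actP' _ _ ca)
      !big_cons !big_nil /= av cv aw bw.
  - by rewrite (act_mul actP _ _ cb) (act_mul actP' _ _ cb)
      !big_cons !big_nil /= bv dv aw bw.
  - by rewrite (act_mul actP _ _ cc) (act_mul actP' _ _ cc)
      !big_cons !big_nil /= av cv cw dw.
  - by rewrite (act_mul actP _ _ cd) (act_mul actP' _ _ cd)
      !big_cons !big_nil /= bv dv cw dw.
apply: (module_algebra_eq genD) => // -[g|||| ] z; try by case: (agreeA z).
by rewrite -iotaP actU actU'.
Qed.

End Extensions.

(** * The two extensions obtained from the square root of [K] *)

Section SquareRootAction.

Context (k : fieldType) (n : nat) (n_ge3 : (3 <= n)%N) (n_odd : odd n).
Context (q : k) (q_prim : n.-primitive_root q).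
Context (U : hopfAlgebra k) (x : uq_gen -> U) (UP : is_uq_sl2 n q x).
Context (D : hopfAlgebra k) (y : double_gen -> D) (DP : is_double_uq_sl2 n q y).
Context (iota : {lrmorphism U -> D}) (iotaP : forall g, iota (x g) = y (DU g)).
Context (gamma delta : k) (gamma_delta : gamma * delta = - q).
Context (rho : U -> cyclic_alg k n -> cyclic_alg k n).
Context (rhoP : is_module_algebra rho).

Local Notation u := (cyclic_gen k n).
Local Notation K := (x UK).
Local Notation E := (x UE).
Local Notation F := (x UF).
Local Notation L := (K ^+ n./2.+1).
Local Notation M := (K ^+ n./2).

Context (rhoK : rho K u = q ^+ 2 *: u).
Context (rhoF : rho F u = gamma *: 1).
Context (rhoE : rho E u = delta *: u ^+ 2).

Let relU : uq_rel n q x. Proof. by case: UP => -[]. Qed.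
Let qn : q ^+ n = 1. Proof. exact: prim_expr_order q_prim. Qed.
Let q_neq0 : q != 0. Proof. exact (prim_root_neq0 n_ge3 q_prim). Qed.
Let bil : bilinear_for *:%R *:%R rho. Proof. by case: rhoP. Qed.
Let rhoM g h z : rho (g * h) z = rho g (rho h z). Proof. by case: rhoP => _ []. Qed.
Let rho1 z : rho 1 z = z. Proof. by case: rhoP => _ []. Qed.

Let rhoKX j z w : rho (K ^+ j) (z * w) = rho (K ^+ j) z * rho (K ^+ j) w.
Proof.
have [_ [[cK _ _] _]] := UP.
elim: j z w => [|j IHj] z w; first by rewrite !expr0 !rho1.
by rewrite !exprS !rhoM IHj (act_mul rhoP _ _ cK) big_seq1.
Qed.

Let rhoKX1 j : rho (K ^+ j) 1 = 1.
Proof.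
have [_ [_ [eK _ _]]] := UP; have [_ _ _ rhoX1] := rhoP.
elim: j => [|j IHj]; first by rewrite expr0 rho1.
by rewrite exprS rhoM IHj rhoX1 eK scale1r.
Qed.

Let rhoKXu j : rho (K ^+ j) u = (q ^+ 2) ^+ j *: u.
Proof.
elim: j => [|j IHj]; first by rewrite !expr0 rho1 scale1r.
by rewrite exprS rhoM IHj actZr // rhoK scalerA (exprSr (q ^+ 2)).
Qed.

Let rhoLu : rho L u = q *: u.
Proof. by rewrite rhoKXu (uq_sqrt_expr n_odd qn). Qed.

Let rhoMu : rho M u = q^-1 *: u.
Proof.
rewrite -[LHS]scale1r -(mulVf q_neq0) -scalerA; congr (_ *: _).
by rewrite -actZr // -rhoLu -rhoM (uq_ML n_odd relU) rho1.
Qed.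

Let rhoE_mul z w : rho E (z * w) = z * rho E w + rho E z * rho K w.
Proof.
have [_ [[_ cE _] _]] := UP.
by rewrite (act_mul rhoP _ _ cE) big_cons big_seq1 /= rho1.
Qed.

(** With K^-1 written as [M * M], applying the rule to L z and L w cancels one [M] against [L]. What
    remains is the product rule prescribed for b by its coproduct. *)
Let rhoF_mul z w : rho F (z * w) = rho (M * M) z * rho F w + rho F z * w.
Proof.
have [_ [[_ _ cF] _]] := UP.
by rewrite (uq_MM _ n_odd) (act_mul rhoP _ _ cF) big_cons big_seq1 /= rho1.
Qed.

Let rhoE1 : rho E 1 = 0.
Proof.
have [_ [_ [_ eE _]]] := UP; have [_ _ _ rhoX1] := rhoP.
by rewrite rhoX1 eE scale0r.
Qed.

Let rhoF1 : rho F 1 = 0.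
Proof.
have [_ [_ [_ _ eF]]] := UP; have [_ _ _ rhoX1] := rhoP.
by rewrite rhoX1 eF scale0r.
Qed.

Let ML z : rho M (rho L z) = z.
Proof. by rewrite -rhoM (uq_ML n_odd relU) rho1. Qed.

Let KM z : rho K (rho M z) = rho L z.
Proof. by rewrite -rhoM -exprS. Qed.

Lemma extension_i : exists rhoD : D -> cyclic_alg k n -> cyclic_alg k n,
  is_extension iota rho rhoD /\ action_i q gamma y rhoD.
Proof.
case: (extension_exists UP DP iotaP rhoP (a := L)
  (b := (1 - q ^- 2) *: (F * L)) (c := 0) (d := M)).
- by apply: uq_double_rel_i => //; [exact: ltnW (ltnW n_ge3) |
    exact: (prim_root_sqr_neq1 n_ge3 q_prim)].
- by move=> z w; rewrite rhoKX (act0l bil) mul0r addr0.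
- move=> z w; rewrite !actZl // !rhoM rhoKX rhoF_mul rhoM ML.
  by rewrite scalerDr addrC -scalerAl -scalerAr.
- by move=> z w; rewrite !(act0l bil) mulr0 mul0r addr0.
- by move=> z w; rewrite rhoKX (act0l bil) mulr0 add0r.
- exact: rhoKX1.
- by rewrite actZl // rhoM rhoKX1 rhoF1 scaler0.
- exact: act0l.
- exact: rhoKX1.
move=> rhoD [ext [ra rb rc rd]]; exists rhoD; split=> //.
split; rewrite ?ra ?rb ?rc ?rd //; last exact: act0l.
(* b u = (1 - q^-2) F (q u) = gamma (q - q^-1) 1. *)
rewrite actZl // rhoM rhoLu actZr // rhoF !scalerA; congr (_ *: _).
by field.
Qed.

Lemma extension_ii : exists rhoD : D -> cyclic_alg k n -> cyclic_alg k n,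
  is_extension iota rho rhoD /\ action_ii q gamma y rhoD.
Proof.
case: (extension_exists UP DP iotaP rhoP (a := M) (b := 0)
  (c := (q^-1 - q) *: (E * M)) (d := L)).
- by apply: uq_double_rel_ii => //; [exact: ltnW (ltnW n_ge3) |
    exact: (prim_root_sqr_neq1 n_ge3 q_prim)].
- by move=> z w; rewrite rhoKX (act0l bil) mulr0 addr0.
- by move=> z w; rewrite !(act0l bil) mulr0 mul0r addr0.
- move=> z w; rewrite !actZl // !rhoM rhoKX rhoE_mul KM.
  by rewrite scalerDr -scalerAl -scalerAr.
- by move=> z w; rewrite rhoKX (act0l bil) mul0r add0r.
- exact: rhoKX1.
- exact: act0l.
- by rewrite actZl // rhoM rhoKX1 rhoE1 scaler0.
- exact: rhoKX1.
move=> rhoD [ext [ra rb rc rd]]; exists rhoD; split=> //.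
split; rewrite ?ra ?rb ?rc ?rd //; first exact: act0l.
(* c u = (q^-1 - q) E (q^-1 u) = (q^-2 - 1) delta u^2, and delta = -q / gamma gives the stated
   coefficient. *)
rewrite actZl // rhoM rhoMu actZr // rhoE !scalerA; congr (_ *: _).
have g0 : gamma != 0.
  by apply: contra_eq_neq gamma_delta => ->; rewrite mul0r eq_sym oppr_eq0.
have -> : delta = - gamma^-1 * q by rewrite mulNr -mulrN -gamma_delta mulKf.
by field; rewrite ?g0 ?q_neq0.
Qed.

End SquareRootAction.

Theorem theorem6p9 (k : closedFieldType) (char0 : [pchar k] =i pred0)
    (n : nat) (n_ge3 : (3 <= n)%N) (n_odd : odd n)
    (q : k) (q_prim : n.-primitive_root q)
    (U : hopfAlgebra k) (x : uq_gen -> U) (UP : is_uq_sl2 n q x)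
    (D : hopfAlgebra k) (y : double_gen -> D) (DP : is_double_uq_sl2 n q y)
    (iota : {lrmorphism U -> D}) (iotaP : forall g, iota (x g) = y (DU g))
    (gamma delta : k) (gamma_delta : gamma * delta = - q)
    (rho : U -> cyclic_alg k n -> cyclic_alg k n)
    (rhoP : is_module_algebra rho)
    (rhoK : rho (x UK) (cyclic_gen k n) = q ^+ 2 *: cyclic_gen k n)
    (rhoF : rho (x UF) (cyclic_gen k n) = gamma *: 1)
    (rhoE : rho (x UE) (cyclic_gen k n) = delta *: cyclic_gen k n ^+ 2) :
  (forall rhoD : D -> cyclic_alg k n -> cyclic_alg k n,
     is_extension iota rho rhoD ->
     action_i q gamma y rhoD \/ action_ii q gamma y rhoD) /\
  (exists rhoD : D -> cyclic_alg k n -> cyclic_alg k n,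
     [/\ is_extension iota rho rhoD, action_i q gamma y rhoD &
         forall rhoD', is_extension iota rho rhoD' -> action_i q gamma y rhoD' ->
           forall h z, rhoD' h z = rhoD h z]) /\
  (exists rhoD : D -> cyclic_alg k n -> cyclic_alg k n,
     [/\ is_extension iota rho rhoD, action_ii q gamma y rhoD &
         forall rhoD', is_extension iota rho rhoD' -> action_ii q gamma y rhoD' ->
           forall h z, rhoD' h z = rhoD h z]).
Proof.
have n_gt1 : (1 < n)%N by apply: leq_trans n_ge3.
(* The formulas for [K] and [F] on u pass from [rho] to [rhoD] along [iota]. *)
split=> [rhoD [rhoDP rhoDU]|].
  by apply: (extension_cases n_ge3 n_odd q_prim DP gamma_delta rhoDP);
    rewrite -iotaP rhoDU.
split.
  have [rhoD [ext act_i]] :=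
    extension_i n_ge3 n_odd q_prim UP DP iotaP rhoP rhoK rhoF.
  exists rhoD; split=> // rhoD' ext' [a' b' c' d'].
  have [a b c d] := act_i; apply: (extension_unique DP iotaP n_gt1 ext ext').
  by rewrite a a' b b' c c' d d'.
have [rhoD [ext act_ii]] :=
  extension_ii n_ge3 n_odd q_prim UP DP iotaP gamma_delta rhoP rhoK rhoE.
exists rhoD; split=> // rhoD' ext' [a' b' c' d'].
have [a b c d] := act_ii; apply: (extension_unique DP iotaP n_gt1 ext ext').
by rewrite a a' b b' c c' d d'.
Qed.
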